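(* If a nontrivial upcycle for $A^n$ has window frame $f$, then some cyclic shift of $f$ is not curtained. In particular, for any $\ell\in A$, the frame $f'$ of the window covering the constant word $\ell^n$ is not curtained.
   Context: Let $A$ be an alphabet with $|A|\ge 2$ letters and $\diamond\notin A$ a wildcard symbol (''diamond''). A partial word is a finite sequence over $A\cup\{\diamond\}$; a cyclic partial word $u=(u_1\cdots u_N)$ is cyclically ordered, with indices taken modulo $N$. A partial word $x$ covers a word $y$ of the same length if for each $i$ either $x_i=\diamond$ or $x_i=y_i$. For $n\ge 1$, the window of $u$ at position $i\in\{1,\dots,N\}$ is $u_i\cdots u_{i+n-1}$. An upcycle for $A^n$ is a cyclic partial word $u=(u_1\cdots u_N)$ such that each word of $A^n$ is covered by the window at exactly one position $i\in\{1,\dots,N\}$. An upcycle is nontrivial if it contains at least one diamond and at least one letter. It is known that the diamonds of an upcycle are $n$-periodic ($u_i=\diamond$ implies $u_{i+n}=\diamond$). The frame of a partial word is the word over $\{\bullet,\diamond\}$ obtained by replacing each letter by $\bullet$ and keeping each $\diamond$; a window frame of an upcycle is the frame of one of its windows. A word $f\in\{\bullet,\diamond\}^n$ is $k$-curtained (for $k\in\{1,\dots,n\}$) if for each $i\in\{1,\dots,k\}$ either $f_i=\diamond$ or $f_{n-k+i}=\diamond$; it is curtained if it is $k$-curtained for some $k\in\{1,\dots,n\}$. *)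

(* Defs.v *)
From mathcomp Require Import all_boot.

Set Implicit Arguments.
Unset Strict Implicit.
Unset Printing Implicit Defensive.

(* [None] is the diamond; positions are numbered from 0. *)
Definition pword (A : Type) := seq (option A).

(* [all2] is false on sequences of different sizes. *)
Definition covers (A : eqType) (x : pword A) (y : seq A) : bool :=
  all2 (fun a b => (a == None) || (a == Some b)) x y.

(* A cyclic partial word is given by one of its linear readings [u]; a window
   may wrap around it several times when [size u < n]. *)
Definition window (A : Type) (n : nat) (u : pword A) (i : nat) : pword A :=
  mkseq (fun j => nth None u ((i + j) %% size u)) n.

Definition upcycle (A : finType) (n : nat) (u : pword A) : Prop :=
  forall w : n.-tuple A, exists! i : 'I_(size u), covers (window n u i) w.

Definition nontrivial (A : eqType) (u : pword A) : Prop :=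
  None \in u /\ exists a : A, Some a \in u.

(* In frames, [true] stands for the diamond and [false] for the bullet. *)
Definition frame (A : Type) (x : pword A) : seq bool :=
  [seq ~~ isSome a | a <- x].

Definition window_frame (A : Type) (n : nat) (u : pword A) (f : seq bool) :
    Prop :=
  exists i : 'I_(size u), f = frame (window n u i).

Definition k_curtained (k : nat) (f : seq bool) : Prop :=
  forall i, i < k -> nth false f i \/ nth false f (size f - k + i).

Definition curtained (f : seq bool) : Prop :=
  exists k, 1 <= k <= size f /\ k_curtained k f.

(* Main.v *)
Require Import Defs.
From mathcomp Require Import all_boot.

Set Implicit Arguments.
Unset Strict Implicit.
Unset Printing Implicit Defensive.

(** Two windows of an upcycle that are pairwise compatible (at each offset, a
    diamond in one of them or equal letters) cover a common word, so they sit at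
    the same position modulo [N = size u].  If the window at [i] covers
    [l ... l] and its frame is [k]-curtained, then the windows at [i] and [i + k]
    are compatible: on the first [n - k] offsets both only show [l] and diamonds,
    and on the last [k] offsets, since the diamonds are [n]-periodic, the curtain
    puts a diamond in one of them.  Hence [N] divides [k <= n], so that every
    window contains all of [u]; then all the letters of [u] are [l], and the
    constant word on another letter is not covered. *)

Definition cyclic_nth (A : Type) (u : pword A) (p : nat) : option A :=
  nth None u (p %% size u).

(* Words of length [n] are represented by functions on [nat], and positions are
   arbitrary naturals, read modulo [size u]. *)
Definition covers_at (A : Type) (n : nat) (u : pword A) (p : nat)
    (w : nat -> A) : Prop :=
  forall j, j < n ->
    cyclic_nth u (p + j) = None \/ cyclic_nth u (p + j) = Some (w j).

Lemma covers_mkseqP (A : eqType) n (u : pword A) p (w : nat -> A) :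
  reflect (covers_at n u p w) (covers (window n u p) (mkseq w n)).
Proof.
have all2_maps (T S R : Type) (r : S -> R -> bool) (f : T -> S) (g : T -> R) s :
  all2 r (map f s) (map g s) = all (fun x => r (f x) (g x)) s.
  by elim: s => //= x s ->.
rewrite /covers /window /mkseq all2_maps.
apply: (iffP allP) => [cov j lt_jn | cov j].
  have /cov/orP[] : j \in iota 0 n by rewrite mem_iota.
    by move/eqP; left.
  by move/eqP; right.
by rewrite mem_iota => /cov[] e; apply/orP; [left|right]; apply/eqP.
Qed.

Lemma cyclic_nth_mod (A : Type) (u : pword A) p q :
  p = q %[mod size u] -> cyclic_nth u p = cyclic_nth u q.
Proof. by rewrite /cyclic_nth => ->. Qed.

Lemma covers_at_mod (A : Type) n (u : pword A) p q w :
  p = q %[mod size u] -> covers_at n u p w -> covers_at n u q w.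
Proof.
move=> eq_pq cov j /cov; rewrite (@cyclic_nth_mod _ _ (p + j) (q + j)) //.
by apply/eqP; rewrite eqn_modDr; apply/eqP.
Qed.

Lemma nth_frame_window (A : Type) n (u : pword A) p j : j < n ->
  nth false (frame (window n u p)) j = ~~ isSome (cyclic_nth u (p + j)).
Proof.
by move=> lt_jn; rewrite (nth_map None) ?size_mkseq // nth_mkseq.
Qed.

Lemma size_frame_window (A : Type) n (u : pword A) p :
  size (frame (window n u p)) = n.
Proof. by rewrite size_map size_mkseq. Qed.

Section Upcycle.

Variables (A : finType) (n : nat) (u : pword A).
Hypotheses (A_gt1 : 2 <= #|A|) (n_gt0 : 1 <= n).
Hypotheses (upcycle_u : upcycle n u) (nontrivial_u : nontrivial u).

Let other_letter (a : A) : exists b, b != a.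
Proof.
have: 0 < #|predC1 a| by rewrite cardC1 -ltnS prednK // ltnW.
by case/card_gt0P=> b; exists b.
Qed.

Let size_u_gt0 : 0 < size u.
Proof. by case: nontrivial_u; case: (u). Qed.

Lemma upcycle_covers_at (w : nat -> A) : exists p, covers_at n u p w.
Proof.
have [i [/= cov _]] := upcycle_u [tuple of mkseq w n].
by exists i; apply/covers_mkseqP.
Qed.

Lemma upcycle_covers_at_inj (w : nat -> A) p q :
  covers_at n u p w -> covers_at n u q w -> p = q %[mod size u].
Proof.
have [i [/= _ uniq_i]] := upcycle_u [tuple of mkseq w n].
suff posE r : covers_at n u r w -> r %% size u = i by move=> /posE-> /posE->.
move=> cov; have := uniq_i (Ordinal (ltn_pmod r size_u_gt0)) _.
move=> -> //; apply/covers_mkseqP.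
by apply: covers_at_mod cov; rewrite /= modn_mod.
Qed.

Lemma upcycle_compatible p q :
  (forall j, j < n -> [\/ cyclic_nth u (p + j) = None,
                          cyclic_nth u (q + j) = None
                        | cyclic_nth u (p + j) = cyclic_nth u (q + j)]) ->
  p = q %[mod size u].
Proof.
have [_ [a _]] := nontrivial_u => compat.
(* The common word takes the letter at [p], else the one at [q]; the filler [a] serves where both
   show a diamond. *)
pose w j := odflt (odflt a (cyclic_nth u (q + j))) (cyclic_nth u (p + j)).
apply: (@upcycle_covers_at_inj w) => j lt_jn; rewrite /w.
  by case: (cyclic_nth u (p + j)); [right | left].
have := compat j lt_jn.
case: (cyclic_nth u (p + j)) => [b|]; case: (cyclic_nth u (q + j)) => [c|] /=;
  try by [left | right].
by case=> // -[->]; right.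
Qed.

(* If [u_(p+n)] were the letter [a], then changing the last letter of a word
   [w a] covered at [p+1] would give a word [w b] covered at some [q+1] with
   [q <> p]; but the window at [q] covers some [y w], and so does the one at
   [p]. *)
Lemma diamond_addn p : cyclic_nth u p = None -> cyclic_nth u (p + n) = None.
Proof.
move=> up; case upn: (cyclic_nth u (p + n)) => [a|//].
have [b neq_ba] := other_letter a.
pose w j := if j == n.-1 then b else odflt a (cyclic_nth u (p.+1 + j)).
have [q0 cov0] := upcycle_covers_at w.
(* This is [q0 - 1] modulo [size u], without truncated subtraction. *)
pose q := q0 + (size u).-1.
have eq_q : q0 = q.+1 %[mod size u].
  by rewrite /q -addnS prednK // modnDr.
have cov := covers_at_mod eq_q cov0.
have eq_pq : p = q %[mod size u].
  pose y := odflt a (cyclic_nth u q).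
  apply: (@upcycle_covers_at_inj (fun j => if j is j'.+1 then w j' else y)).
    case=> [|j] lt_jn; first by rewrite addn0; left.
    rewrite /w addnS -addSn; case: eqP => [ej|_].
      by move: lt_jn; rewrite ej prednK // ltnn.
    by case: (cyclic_nth u _) => [c|]; [right | left].
  case=> [|j] lt_jn.
    by rewrite addn0 /y; case: (cyclic_nth u q); [right | left].
  by rewrite addnS -addSn; apply: cov; apply: ltnW.
have := cov n.-1; rewrite addSn -addnS !prednK // => /(_ (leqnn _)).
rewrite (@cyclic_nth_mod _ _ (q + n) (p + n)); last first.
  by apply/eqP; rewrite eqn_modDr eq_sym; apply/eqP.
rewrite upn /w eqxx => -[//|[ab]].
by rewrite ab eqxx in neq_ba.
Qed.

Lemma diamond_periodic p :
  isSome (cyclic_nth u (p + n)) = isSome (cyclic_nth u p).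
Proof.
case up: (cyclic_nth u p) => [a|]; last by rewrite (diamond_addn up).
case upn: (cyclic_nth u (p + n)) => [//|].
(* Steps of [n] propagate the diamond at [p + n]; the [size u]-th step from [p] lands on [p] again,
   which holds a letter. *)
suff: cyclic_nth u (p + size u * n) = None.
  by rewrite (@cyclic_nth_mod _ _ _ p) ?up // mulnC addnC modnMDl.
rewrite -(prednK size_u_gt0); elim: (_.-1) => [|m IHm]; first by rewrite mul1n.
by rewrite mulSn addnCA addnC diamond_addn.
Qed.

Lemma constant_frame_not_curtained (l : A) p :
  covers_at n u p (fun=> l) -> ~ curtained (frame (window n u p)).
Proof.
move=> cov [k []]; rewrite size_frame_window => /andP[k_gt0 le_kn] curt.
have: p = p + k %[mod size u].
  apply: upcycle_compatible => j lt_jn.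
  have [lt_jkn | le_nkj] := ltnP j (n - k).
    rewrite -addnA; have lt_kj : k + j < n by rewrite -ltn_subRL.
    by case: (cov _ lt_jn) => ->; case: (cov _ lt_kj) => ->; constructor.
  pose m := j - (n - k).
  have ej : j = n - k + m by rewrite subnKC.
  have lt_mk : m < k by rewrite -(ltn_add2l (n - k)) -ej subnK.
  have := curt m lt_mk; rewrite size_frame_window -ej.
  rewrite !nth_frame_window ?(leq_trans lt_mk) //.
  (* Offset [j] of the second window lies [n] places after offset [m] of the first, so a diamond at
     [m] recurs there. *)
  have -> : p + k + j = p + m + n.
    by rewrite ej -!addnA (addnA k) subnKC // (addnC n).
  case=> [/negPf um | uj]; last first.
    by move: uj; case: cyclic_nth => // _; constructor 1.
  constructor 2; move: um; rewrite -diamond_periodic.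
  by case: cyclic_nth.
move/eqP; rewrite -{1}[p]addn0 eqn_modDl mod0n eq_sym.
move/(dvdn_leq k_gt0) => le_Nk.
have le_Nn := leq_trans le_Nk le_kn.
have [b neq_bl] := other_letter l.
have [q covb] := upcycle_covers_at (fun=> b).
(* The offset is [j - r] modulo [size u], which is below [n] because [size u <= n]. *)
have full r (j : nat) : exists2 t, t < n & r + t = j %[mod size u].
  exists ((j + (size u - r %% size u)) %% size u).
    exact: leq_trans (ltn_pmod _ size_u_gt0) le_Nn.
  rewrite modnDmr -modnDml addnC -addnA subnK ?modnDr //.
  exact/ltnW/ltn_pmod.
have [_ [a /(nthP None)[j lt_jN uj]]] := nontrivial_u.
have uja : cyclic_nth u j = Some a by rewrite /cyclic_nth modn_small.
have letterE c r : covers_at n u r (fun=> c) -> a = c.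
  move=> covc; have [t lt_tn /cyclic_nth_mod et] := full r j.
  by case: (covc t lt_tn); rewrite et uja => // -[].
by rewrite -(letterE _ _ covb) -(letterE _ _ cov) eqxx in neq_bl.
Qed.

(** Moving a window one place drops its first frame symbol and, by [n]-periodicity, appends that
    same symbol. *)
Lemma frame_window_rot p m :
  exists r, frame (window n u (p + m)) = rot r (frame (window n u p)).
Proof.
elim: m => [|m [r IHm]]; first by exists 0; rewrite addn0 rot0.
have step q : frame (window n u q.+1) = rot 1 (frame (window n u q)).
  rewrite /window; case: (n) n_gt0 diamond_periodic => // n' _ per.
  rewrite /frame /mkseq -!map_comp [in RHS]/= rot1_cons.
  have -> : iota 0 n'.+1 = rcons (iota 0 n') n' by rewrite -addn1 iotaD cats1.
  rewrite map_rcons (iotaDl 1 0) -map_comp.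
  congr rcons.
    by apply: eq_map => j /=; rewrite add1n addnS addSn.
  by have := per q; rewrite /cyclic_nth /= addn0 addSnnS => ->.
(* [rotS] needs [r] below the length; beyond it [rot r] is the identity and the count restarts at
   1. *)
have [lt_rn | le_nr] := ltnP r (size (frame (window n u p))).
  by exists r.+1; rewrite addnS step IHm -rotS.
by exists 1; rewrite addnS step IHm (rot_oversize le_nr).
Qed.

End Upcycle.

Theorem theorem8p4 (A : finType) (hA : 2 <= #|A|) (n : nat) (hn : 1 <= n)
    (u : pword A) (hu : upcycle n u) (hnt : nontrivial u) :
  (forall f : seq bool, window_frame n u f ->
     exists r : nat, ~ curtained (rot r f)) /\
  (forall (l : A) (i : 'I_(size u)), covers (window n u i) (nseq n l) ->
     ~ curtained (frame (window n u i))).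
Proof.
split=> [f [i ->] | l i].
  have [_ [l _]] := hnt.
  have [p cov] := upcycle_covers_at hu (fun=> l).
  (* The shift is [p - i] modulo [size u], so the window reached is the one covering the constant
     word. *)
  have [r er] := frame_window_rot hA hn hu hnt i (p + (size u - i)).
  exists r; rewrite -er; apply: constant_frame_not_curtained => //.
  apply: covers_at_mod cov.
  by rewrite addnCA subnKC ?modnDr // ltnW.
have -> : nseq n l = mkseq (fun=> l) n.
  apply: (@eq_from_nth _ l) => [|j]; rewrite size_nseq ?size_mkseq // => lt_jn.
  by rewrite nth_nseq lt_jn nth_mkseq.
by move/covers_mkseqP; apply: constant_frame_not_curtained.
Qed.
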